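(* For every $\mathcal{TEL}^{\bigcirc}_{\mathit{lin}}$-TBox $\mathcal{T}$ there exists a context-free grammar $\Gamma_\mathcal{T}=(N,\{c,d\},R)$ of size polynomial in $|\mathcal{T}|$ such that for any concept names $A,B$ occurring in $\mathcal{T}$ there is a nonterminal $\mathcal{N}_{AB}\in N$ such that for all $n\in\mathbb{Z}$: $\mathcal{T}\models A\sqsubseteq\bigcirc^nB$ if and only if there exists $w\in L_{\Gamma_\mathcal{T}}(\mathcal{N}_{AB})$ with $\#c(w)-\#d(w)=n$.
   Context: A $\mathcal{TEL}^{\bigcirc}$-TBox is a finite set of concept inclusions $A\sqsubseteq\bigcirc^nB$, $A\sqcap A'\sqsubseteq B$, $\exists r.A\sqsubseteq B$, $A\sqsubseteq\exists r.B$ ($A,A',B$ concept names, $r$ a role name, rigid or local, $n\in\mathbb{Z}$); it is a $\mathcal{TEL}^{\bigcirc}_{\mathit{lin}}$-TBox if it has no inclusions of the form $A\sqcap A'\sqsubseteq B$. Semantics: an interpretation is a family $(\mathcal{I}_i)_{i\in\mathbb{Z}}$ of classical DL interpretations over a common domain, rigid role names interpreted identically at all $i$; $(\bigcirc^nA)^{i}=A^{i+n}$, $(\exists r.A)^i=\{d\mid\exists e\in A^i,(d,e)\in r^i\}$; $C\sqsubseteq D$ holds if $C^i\subseteq D^i$ for all $i$; $\models$ is entailment. $|\mathcal{T}|$ counts integers in unary. $\#x(w)$ is the number of occurrences of letter $x$ in $w$; $L_\Gamma(\mathcal{N})$ is the language generated from nonterminal $\mathcal{N}$. *)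

(* Defs.v *)
From HB Require Import structures.
From Stdlib Require Import Relation_Operators.
From mathcomp Require Import all_boot all_order all_algebra.
From mathcomp Require Import finmap.

Set Implicit Arguments.
Unset Strict Implicit.
Unset Printing Implicit Defensive.

Local Open Scope ring_scope.
Local Open Scope fset_scope.

Section Syntax.
Variables NC NR : Type.

Inductive concept : Type :=
  | Atom of NC
  | And of concept & concept
  | Ex of NR & concept
  | Next of int & concept.

Variant inclusion : Type :=
  | SubNext of NC & int & NC
  | SubAnd of NC & NC & NC
  | SubExL of NR & NC & NC
  | SubExR of NC & NR & NC.

Definition lhs (a : inclusion) : concept :=
  match a with
  | SubNext A _ _ => Atom A
  | SubAnd A A' _ => And (Atom A) (Atom A')
  | SubExL r A _ => Ex r (Atom A)
  | SubExR A _ _ => Atom A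
  end.

Definition rhs (a : inclusion) : concept :=
  match a with
  | SubNext _ n B => Next n (Atom B)
  | SubAnd _ _ B => Atom B
  | SubExL _ _ B => Atom B
  | SubExR _ r B => Ex r (Atom B)
  end.

Definition is_conj (a : inclusion) : bool :=
  if a is SubAnd _ _ _ then true else false.

Definition inclusion_code (a : inclusion) :
    (NC * int * NC) + (NC * NC * NC) + ((NR * NC * NC) + (NC * NR * NC)) :=
  match a with
  | SubNext A n B => inl (inl (A, n, B))
  | SubAnd A A' B => inl (inr (A, A', B))
  | SubExL r A B => inr (inl (r, A, B))
  | SubExR A r B => inr (inr (A, r, B))
  end.

Definition inclusion_decode
    (x : (NC * int * NC) + (NC * NC * NC) + ((NR * NC * NC) + (NC * NR * NC))) :
    inclusion :=
  match x with
  | inl (inl (A, n, B)) => SubNext A n B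
  | inl (inr (A, A', B)) => SubAnd A A' B
  | inr (inl (r, A, B)) => SubExL r A B
  | inr (inr (A, r, B)) => SubExR A r B
  end.

Lemma inclusion_codeK : cancel inclusion_code inclusion_decode.
Proof. by case. Qed.

Fixpoint concept_names (C : concept) : seq NC :=
  match C with
  | Atom A => [:: A]
  | And C1 C2 => concept_names C1 ++ concept_names C2
  | Ex _ C1 => concept_names C1
  | Next _ C1 => concept_names C1
  end.

(* Number of symbols, the exponent of O^n being written in unary. *)
Fixpoint concept_size (C : concept) : nat :=
  match C with
  | Atom _ => 1
  | And C1 C2 => (concept_size C1 + concept_size C2).+1
  | Ex _ C1 => (concept_size C1).+2
  | Next n C1 => (`|n| + concept_size C1).+1
  end.

Definition inclusion_size (a : inclusion) : nat :=
  (concept_size (lhs a) + concept_size (rhs a)).+1.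

End Syntax.

Arguments Atom {NC NR} _.

HB.instance Definition _ (NC NR : choiceType) :=
  Choice.copy (inclusion NC NR) (can_type (@inclusion_codeK NC NR)).

Section TBoxes.
Variables NC NR : choiceType.

Definition tbox : Type := {fset inclusion NC NR}.

Definition linear_tbox (T : tbox) : Prop :=
  forall a, a \in T -> ~~ is_conj a.

Definition tbox_size (T : tbox) : nat :=
  (\sum_(a <- enum_fset T) inclusion_size a)%N.

Definition occurs_in (A : NC) (T : tbox) : Prop :=
  exists2 a, a \in T &
    (A \in concept_names (lhs a)) || (A \in concept_names (rhs a)).

End TBoxes.

Section Semantics.
Variables (NC NR : choiceType) (rigid : pred NR).

(* A role name r is rigid if [rigid r] holds and local otherwise. *)
Record interpretation : Type := Interpretation {
  domain : Type;
  domain_inhabited : inhabited domain;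
  int_concept : int -> NC -> domain -> Prop;
  int_role : int -> NR -> domain -> domain -> Prop;
  int_rigid : forall r, rigid r -> forall i j x y,
    int_role i r x y <-> int_role j r x y
}.

Fixpoint extension (I : interpretation) (i : int) (C : concept NC NR) :
    domain I -> Prop :=
  match C with
  | Atom A => int_concept i A
  | And C1 C2 => fun x => extension i C1 x /\ extension i C2 x
  | Ex r C1 => fun x => exists2 y, extension i C1 y & int_role i r x y
  | Next n C1 => extension (i + n) C1
  end.

Definition satisfies (I : interpretation) (C D : concept NC NR) : Prop :=
  forall i (x : domain I), extension i C x -> extension i D x.

Definition is_model (I : interpretation) (T : tbox NC NR) : Prop :=
  forall a, a \in T -> satisfies I (lhs a) (rhs a).

Definition entails (T : tbox NC NR) (C D : concept NC NR) : Prop :=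
  forall I, is_model I T -> satisfies I C D.

End Semantics.

Section Grammars.
Variable L : choiceType.

(* No start symbol: the language is taken relative to a chosen nonterminal. *)
Record grammar : Type := Grammar {
  nonterminal : finType;
  rules : {fset nonterminal * seq (nonterminal + L)}
}.

Definition grammar_size (G : grammar) : nat :=
  (#|nonterminal G| + \sum_(rho <- enum_fset (rules G)) (size rho.2).+1)%N.

Variant derives1 (G : grammar) :
    seq (nonterminal G + L) -> seq (nonterminal G + L) -> Prop :=
  Derives1 u v X s of (X, s) \in rules G :
    derives1 (u ++ inl X :: v) (u ++ s ++ v).

Definition language (G : grammar) (X : nonterminal G) (w : seq L) : Prop :=
  clos_refl_trans _ (@derives1 G) [:: inl X] (map inr w).

End Grammars.

Variant letter : Type := letter_c | letter_d.

Definition letter_code (x : letter) : bool :=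
  if x is letter_c then true else false.
Definition letter_decode (b : bool) : letter := if b then letter_c else letter_d.
Lemma letter_codeK : cancel letter_code letter_decode.
Proof. by case. Qed.

HB.instance Definition _ := Finite.copy letter (can_type letter_codeK).

(* Main.v *)
(** The grammar has a nonterminal (A, B) for each pair of names of the TBox, and
    as productions all the sound ones of three shapes: (A, B) -> x^m for a letter
    x and m at most the size of the TBox, (A, B) -> Y and (A, B) -> Y Z.
    A production is sound if every weight obtained from its right-hand side, when
    each nonterminal (A', B') is replaced by any n such that the TBox entails
    A' <= O^n B', is entailed for (A, B). Soundness of the generated weights is
    then immediate. Conversely, the generated weights define a model: its points
    are pairs (B, i), "an element created in B at time i", belonging to C at time
    j if (B, C) generates j - i. An axiom A <= exists r.B followed by
    exists r.C <= D contributes (A, D) -> (B, C) if r is rigid, and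
    (A, D) -> epsilon if r is local and (B, C) generates 0. Conjunctions would
    require two generated weights to coincide, hence the linearity assumption. *)
Require Import Defs.
From HB Require Import structures.
From Stdlib Require Import Relation_Operators.
From mathcomp Require Import all_boot all_order all_algebra.
From mathcomp Require Import finmap boolp zify.

Set Implicit Arguments.
Unset Strict Implicit.
Unset Printing Implicit Defensive.

Import Order.TTheory GRing.Theory Num.Theory.
Local Open Scope ring_scope.

(** * Closure properties of context-free derivations *)

Section Derivations.
Variables (L : choiceType) (G : grammar L).

Definition derives := clos_refl_trans _ (@derives1 L G).

Lemma derives_context p q u v : derives u v -> derives (p ++ u ++ q) (p ++ v ++ q).
Proof.
elim=> {u v} [_ _ [u v X s Xs]|u|u v w _ uv _ vw].
- apply: rt_step; have := Derives1 (p ++ u) (v ++ q) Xs.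
  by rewrite -!catA.
- exact: rt_refl.
- exact: rt_trans uv vw.
Qed.

Lemma derives_cat u u' v v' :
  derives u u' -> derives v v' -> derives (u ++ v) (u' ++ v').
Proof.
move=> uu' vv'; apply: (@rt_trans _ _ _ (u' ++ v)).
  exact: (derives_context [::] v uu').
by have := derives_context u' [::] vv'; rewrite !cats0.
Qed.

Lemma derives_rule X s w : (X, s) \in rules G -> derives s w -> derives [:: inl X] w.
Proof.
move=> Xs sw; apply: rt_trans sw; apply: rt_step.
by have := Derives1 [::] [::] Xs; rewrite /= cats0.
Qed.

End Derivations.

(** * Weights of words and of sentential forms *)

Definition weight (w : seq letter) : int :=
  (count_mem letter_c w)%:Z - (count_mem letter_d w)%:Z.

Lemma weight_cat u v : weight (u ++ v) = weight u + weight v.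
Proof. rewrite /weight !count_cat; lia. Qed.

Section Weights.
Variables (V : Type) (E : V -> int -> Prop).

(** Membership of [n] in the Minkowski sum of the weight sets of the symbols of [s], where a
    nonterminal [X] has the set [E X]. *)
Fixpoint yields (s : seq (V + letter)) (n : int) : Prop :=
  match s with
  | [::] => n = 0
  | inl X :: s' => exists2 m, E X m & yields s' (n - m)
  | inr x :: s' => yields s' (n - weight [:: x])
  end.

Lemma yields_cat u v n :
  yields (u ++ v) n <-> exists2 m, yields u m & yields v (n - m).
Proof.
elim: u n => [|[X|x] u IHu] n /=.
- by split=> [vn|[_ -> /[!subr0]]//]; exists 0; rewrite ?subr0.
- split=> [[m Xm /IHu[k uk vk]]|[k [m Xm uk] vk]].
    exists (k + m); first by exists m; rewrite ?addrK.
    by have -> : n - (k + m) = n - m - k by lia.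
  exists m => //; apply/IHu; exists (k - m) => //.
  by have -> : n - m - (k - m) = n - k by lia.
- split=> [/IHu[k uk vk]|[k uk vk]].
    exists (k + weight [:: x]); first by rewrite addrK.
    by have -> : n - (k + weight [:: x]) = n - weight [:: x] - k by lia.
  apply/IHu; exists (k - weight [:: x]) => //.
  by have -> : n - weight [:: x] - (k - weight [:: x]) = n - k by lia.
Qed.

Lemma yields_word w n : yields (map inr w) n <-> n = weight w.
Proof.
elim: w n => [|x w IHw] n //=; rewrite IHw -(cat1s x w) weight_cat; lia.
Qed.

End Weights.

Section WeightedGrammar.
Variable G : grammar letter.

Definition generates (s : seq (nonterminal G + letter)) (n : int) : Prop :=
  exists2 w, derives s (map inr w) & weight w = n.

Lemma generates_word w : generates (map inr w) (weight w).
Proof. by exists w => //; apply: rt_refl. Qed.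

Lemma generates_cat u v m n :
  generates u m -> generates v n -> generates (u ++ v) (m + n).
Proof.
move=> [w uw <-] [w' vw' <-]; exists (w ++ w'); last exact: weight_cat.
by rewrite map_cat; apply: derives_cat.
Qed.

Lemma generates_rule X s n :
  (X, s) \in rules G -> generates s n -> generates [:: inl X] n.
Proof. by move=> Xs [w sw wn]; exists w => //; apply: derives_rule sw. Qed.

(** Yielded weights are pulled back along derivation steps, starting from the terminal word, which
    yields only its own weight. *)
Lemma generates_sound (E : nonterminal G -> int -> Prop) :
  (forall X s n, (X, s) \in rules G -> yields E s n -> E X n) ->
  forall X n, generates [:: inl X] n -> E X n.
Proof.
move=> soundE X n [w Xw wn].
have yields_derives u v : derives u v -> forall k, yields E v k -> yields E u k.
  elim=> {u v} [_ _ [u v Y s Ys] k|//|u v u' _ IHv _ IHu' k /IHu' /IHv //].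
  move=> /yields_cat[m um /yields_cat[m' sm' vm']].
  apply/yields_cat; exists m => //.
  by exists m' => //; apply: soundE sm'.
have /yields_derives/(_ n) := Xw.
case=> [|m Xm nm]; first by apply/yields_word.
rewrite /= in nm; have -> : n = m by lia.
exact: Xm.
Qed.

End WeightedGrammar.

(** * The grammar of all sound productions of bounded shape *)

Section SoundGrammar.
Variables (V : finType) (E : V -> int -> Prop) (t : nat).

Definition shapes : seq (seq (V + letter)) :=
  [seq nseq m (inr x) | x <- [:: letter_c; letter_d], m <- iota 0 t.+1]
  ++ [seq [:: inl X] | X <- enum V]
  ++ [seq [:: inl X; inl Y] | X <- enum V, Y <- enum V].

(** [E] is an arbitrary relation, so soundness becomes boolean by classical logic only. *)
Definition sound (rho : V * seq (V + letter)) : bool :=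
  `[< forall n, yields E rho.2 n -> E rho.1 n >].

Definition candidates := [seq (X, s) | X <- enum V, s <- shapes].

Definition sound_grammar : grammar letter :=
  Grammar [fset rho in candidates | sound rho]%fset.

Lemma sound_grammarP X s : reflect
  (s \in shapes /\ forall n, yields E s n -> E X n) ((X, s) \in rules sound_grammar).
Proof.
rewrite !inE /=; apply: (iffP andP) => -[sS soundXs]; split.
- by case/allpairsP: sS => -[Y s'] [_ s'S [_ ->]].
- exact/asboolP.
- by apply/allpairsP; exists (X, s); split; rewrite ?mem_enum.
- exact/asboolP.
Qed.

Lemma sound_grammar_sound X n :
  generates (G := sound_grammar) [:: inl X] n -> E X n.
Proof. by move: X n; apply: generates_sound => X s n /sound_grammarP[_]; apply. Qed.

Lemma shapes_weight (n : int) :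
  (`|n| <= t)%N -> exists2 w, weight w = n & map inr w \in shapes.
Proof.
move=> nt; exists (nseq `|n| (if 0 <= n then letter_c else letter_d)).
  by rewrite /weight !count_nseq; case: ifP => n0 /=; lia.
rewrite mem_cat map_nseq; apply/orP; left; apply/allpairsP.
exists ((if 0 <= n then letter_c else letter_d), `|n|%N).
by split; [case: (0 <= n)|rewrite mem_iota add0n ltnS|].
Qed.

Lemma sound_grammar_const X n :
  (`|n| <= t)%N -> E X n -> generates (G := sound_grammar) [:: inl X] n.
Proof.
move=> nt Xn; have [w wn wS] := shapes_weight nt.
apply: (@generates_rule sound_grammar _ (map inr w)).
  by apply/sound_grammarP; split=> // k /yields_word ->; rewrite wn.
by rewrite -wn; apply: generates_word.
Qed.

Lemma sound_grammar_unit X Y n : (forall m, E Y m -> E X m) ->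
  generates (G := sound_grammar) [:: inl Y] n ->
  generates (G := sound_grammar) [:: inl X] n.
Proof.
move=> XY; apply: generates_rule; apply/sound_grammarP; split.
  rewrite !mem_cat; apply/or3P; apply: Or32; apply/mapP.
  by exists Y; rewrite ?mem_enum.
move=> k /= [m Ym km]; have -> : k = m by lia.
exact: XY.
Qed.

Lemma sound_grammar_concat X Y Z m n :
  (forall m n, E Y m -> E Z n -> E X (m + n)) ->
  generates (G := sound_grammar) [:: inl Y] m ->
  generates (G := sound_grammar) [:: inl Z] n ->
  generates (G := sound_grammar) [:: inl X] (m + n).
Proof.
move=> XYZ Ym Zn; apply: (generates_rule _ (generates_cat Ym Zn)).
apply/sound_grammarP; split.
  rewrite !mem_cat; apply/or3P; apply: Or33; apply/allpairsP.
  by exists (Y, Z); rewrite !mem_enum.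
move=> k /= [k1 Yk1 [k2 Zk2 kE]].
have -> : k = k1 + k2 by lia.
exact: XYZ.
Qed.

Lemma sound_grammar_size :
  (grammar_size sound_grammar
     <= #|V| + #|V| * (2 * t.+1 + #|V| + #|V| ^ 2) * (t + 3))%N.
Proof.
rewrite leq_add2l.
(* A right-hand side has length at most the maximum of [t] and 2, so a rule costs at most
   [t + 3]. *)
apply: (@leq_trans (\sum_(rho <- candidates) (t + 3))); last first.
  rewrite big_const_seq count_predT iter_addn_0 mulnC leq_mul2r; apply/orP; right.
  by rewrite /candidates /shapes !(size_allpairs, size_cat) -!cardE size_map -cardE size_iota mulnn addnA.
apply: (@leq_trans (\sum_(rho <- candidates) (size rho.2).+1)).
  (* The candidates may repeat (both letters give the empty word) while the rules form a set, so
     multiplicities are compared. *)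
  apply: sub_le_big_seq => //; first by move=> *; apply: leq_addr.
  move=> rho; rewrite count_uniq_mem ?fset_uniq //.
  case: (boolP (rho \in _)) => //.
  by rewrite !inE /= => /andP[rhoC _]; move: rhoC; rewrite -has_pred1 has_count.
rewrite big_seq [leqRHS]big_seq; apply: leq_sum => rho.
case/allpairsP=> -[X s] [_ sS ->] /=; move: sS; rewrite mem_cat => /orP[|].
  case/allpairsP => -[x m] [_ mt /= ->]; rewrite size_nseq; move: mt.
  by rewrite mem_iota /=; lia.
rewrite mem_cat => /orP[/mapP[Y _ /= -> /=]|]; first by lia.
by case/allpairsP => -[Y Z] [_ _ /= -> /=]; lia.
Qed.

End SoundGrammar.

(** * Entailments between concept names and their grammar *)

Section Entailment.
Variables (NC NR : choiceType) (rigid : pred NR) (T : tbox NC NR).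

Definition reaches (A : NC) (n : int) (B : NC) : Prop :=
  entails rigid T (Atom A) (Next n (Atom B)).

Lemma reaches_refl A : reaches A 0 A.
Proof. by move=> I _ i x /=; rewrite addr0. Qed.

Lemma reaches_trans A B C m n : reaches A m B -> reaches B n C -> reaches A (m + n) C.
Proof.
by move=> AB BC I mI i x /(AB I mI) /(BC I mI); rewrite /= addrA.
Qed.

Lemma reaches_next A n B : SubNext NR A n B \in T -> reaches A n B.
Proof. by move=> ABT I mI; apply: mI ABT. Qed.

(** The [B]-witness at time [i] lies in [C] at time [i + m]; its edge is still there at that time by
    rigidity, or because no time has passed. *)
Lemma reaches_exists A r B C D m :
  SubExR A r B \in T -> SubExL r C D \in T -> rigid r \/ m = 0 ->
  reaches B m C -> reaches A m D.
Proof.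
move=> ABT CDT rm BC I mI i x xA.
have [y yB xy] := mI _ ABT i x xA.
apply: (mI _ CDT (i + m) x); exists y; first exact: BC yB.
case: rm => [rr|->]; last by rewrite addr0.
exact: (int_rigid rr i (i + m) x y).1.
Qed.

Definition names : seq NC :=
  undup (flatten [seq concept_names (lhs a) ++ concept_names (rhs a) | a <- enum_fset T]).

Lemma mem_names A : occurs_in A T -> A \in names.
Proof.
move=> [a aT Aa]; rewrite mem_undup; apply/flattenP.
exists (concept_names (lhs a) ++ concept_names (rhs a)); last by rewrite mem_cat.
by apply/mapP; exists a.
Qed.

Lemma size_concept_names (C : concept NC NR) :
  (size (concept_names C) <= concept_size C)%N.
Proof. by elim: C => //= [C ? D ?|r C ?|n C ?]; rewrite ?size_cat; lia. Qed.

Lemma size_names : (size names <= tbox_size T)%N.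
Proof.
apply: leq_trans (size_undup _) _.
rewrite size_flatten sumnE !big_map; apply: leq_sum => a _.
by rewrite size_cat; apply/leqW/leq_add; apply: size_concept_names.
Qed.

Lemma inclusion_size_le a : a \in T -> (inclusion_size a <= tbox_size T)%N.
Proof. by move=> aT; rewrite /tbox_size (big_rem a) //= leq_addr. Qed.

Definition name : finType := seq_sub names.

Definition pair_reaches (X : name * name) (n : int) : Prop :=
  reaches (val X.1) n (val X.2).

Definition tbox_grammar : grammar letter := sound_grammar pair_reaches (tbox_size T).

Definition gen (A B : name) (n : int) : Prop :=
  generates (G := tbox_grammar) [:: inl (A, B)] n.

Lemma gen_sound A B n : gen A B n -> reaches (val A) n (val B).
Proof. exact: sound_grammar_sound. Qed.

Lemma gen_zero A B : reaches (val A) 0 (val B) -> gen A B 0.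
Proof. by move=> AB; apply: sound_grammar_const. Qed.

Lemma gen_next A B n : SubNext NR (val A) n (val B) \in T -> gen A B n.
Proof.
move=> ABT; apply: sound_grammar_const; last exact: reaches_next.
(* Unary coding bounds the absolute value of [n] by the size of the axiom. *)
by apply: leq_trans (inclusion_size_le ABT); rewrite /inclusion_size /=; lia.
Qed.

Lemma gen_trans A B C m n : gen A B m -> gen B C n -> gen A C (m + n).
Proof. by apply: sound_grammar_concat => ? ?; apply: reaches_trans. Qed.

Lemma gen_exists A r B C D m :
  SubExR (val A) r (val B) \in T -> SubExL r (val C) (val D) \in T ->
  rigid r \/ m = 0 -> gen B C m -> gen A D m.
Proof.
move=> ABT CDT [rr|m0] BC.
  by apply: sound_grammar_unit BC => k; apply: reaches_exists ABT CDT _; left.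
(* For a local role a unit production could be unsound at nonzero weights; the derivation of 0 is
   turned into an entailment that makes the empty production sound. *)
rewrite m0 in BC *; apply: gen_zero.
by apply: (reaches_exists ABT CDT _ (gen_sound BC)); right.
Qed.

(** * The model built from generated weights *)

Definition model_concept (j : int) (C : NC) (x : name * int) : Prop :=
  exists2 C', val C' = C & gen x.1 C' (j - x.2).

(** The edge arises at the creation time [y.2] of [y], when [x] belongs to some [A] demanding it;
    all such [x] share the witness [y]. *)
Definition model_role (j : int) (r : NR) (x y : name * int) : Prop :=
  exists A, [/\ SubExR (val A) r (val y.1) \in T, gen x.1 A (y.2 - x.2)
              & rigid r \/ j = y.2].

Lemma model_rigid r : rigid r -> forall i j x y,
  model_role i r x y <-> model_role j r x y.
Proof. by move=> rr i j x y; split=> -[A [AT xA _]]; exists A; split=> //; left. Qed.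

Definition model (A : name) : interpretation NC rigid :=
  Interpretation (inhabits (A, 0 : int)) model_concept model_rigid.

Lemma occurs_rhs a B : a \in T -> B \in concept_names (rhs a) -> B \in names.
Proof. by move=> aT Ba; apply: mem_names; exists a; rewrite ?Ba ?orbT. Qed.

Lemma model_is_model A : linear_tbox T -> is_model (model A) T.
Proof.
move=> linT [B n C|B B' C|r C D|B r C] aT j [X i] /=.
- move=> [B' B'E XB]; have CN : C \in names by apply: occurs_rhs aT _; rewrite inE.
  exists (SeqSub CN) => //=; rewrite addrAC; apply: gen_trans XB _.
  by apply: gen_next; rewrite B'E.
- by have := linT _ aT.
- move=> [[Y k] [C' C'E YC] [A' [/= A'T XA' rk]]].
  have DN : D \in names by apply: occurs_rhs aT _; rewrite inE.
  exists (SeqSub DN) => //=.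
  (* The time is split at the creation time [k] of the witness; for a local role the second part is
     0. *)
  have -> : j - i = (k - i) + (j - k) by lia.
  apply: gen_trans XA' _.
  apply: gen_exists A'T _ _ YC; first by rewrite C'E; exact: aT.
  by case: rk => [|->]; [left|right; rewrite subrr].
- move=> [B' B'E XB]; have CN : C \in names by apply: occurs_rhs aT _; rewrite inE.
  (* The witness is the element created in [C] at the current time. *)
  exists (SeqSub CN, j).
    by exists (SeqSub CN) => //=; rewrite subrr; apply/gen_zero/reaches_refl.
  by exists B'; split=> //=; [rewrite B'E|right].
Qed.

(** The entailment is evaluated in the model at the point [(A, 0)], which belongs to [A] at time
    0. *)
Lemma gen_complete A B n : linear_tbox T -> reaches (val A) n (val B) -> gen A B n.
Proof.
move=> linT AB; have := AB _ (@model_is_model A linT) 0 (A, 0).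
case=> [|B' /val_inj ->] /=; last by rewrite add0r subr0.
by exists A => //=; rewrite subrr; apply/gen_zero/reaches_refl.
Qed.

Lemma card_pairs : (#|{: name * name}| <= tbox_size T ^ 2)%N.
Proof.
by rewrite card_prod card_seq_sub ?undup_uniq // -mulnn leq_mul ?size_names.
Qed.

End Entailment.

Theorem theorem7 :
  exists p : {poly nat},
    forall (NC NR : choiceType) (rigid : pred NR) (T : tbox NC NR),
      linear_tbox T ->
      exists G : grammar letter,
        (grammar_size G <= p.[tbox_size T])%N /\
        forall A B : NC, occurs_in A T -> occurs_in B T ->
          exists X : nonterminal G,
            forall n : int,
              entails rigid T (Atom A) (Next n (Atom B)) <->
              exists2 w : seq letter, language X w &
                (count_mem letter_c w)%:Z - (count_mem letter_d w)%:Z = n.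
Proof.
(* This is the bound of [sound_grammar_size] with the number of nonterminals replaced by the square
   of the TBox size. *)
exists ('X^2 + 'X^2 * (2%N%:P * ('X + 1%N%:P) + 'X^2 + 'X^4) * ('X + 3%N%:P)).
move=> NC NR rigid T linT; exists (tbox_grammar rigid T); split.
  apply: leq_trans (sound_grammar_size _ _) _.
  rewrite !(hornerD, hornerM, hornerXn, hornerX, hornerC) !natrDE !natrME.
  have := card_pairs T; set k := #|_|; set t := tbox_size T => kt.
  have kt2 : (k ^ 2 <= t ^ 4)%N by rewrite (expnM t 2 2) leq_exp2r.
  by rewrite addn1 leq_add // leq_mul // leq_mul // leq_add // leq_add.
move=> A B /mem_names AN /mem_names BN.
exists (SeqSub AN, SeqSub BN) => n; split.
  exact: (@gen_complete _ _ _ _ (SeqSub AN) (SeqSub BN)).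
exact: (@gen_sound _ _ _ _ (SeqSub AN) (SeqSub BN)).
Qed.
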